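(* Let $\mathbf Z \in C_{q+1}([0,T])\times C_p(S^1)$ be a solution of the continuous space-time finite element method $$\int_0^T\!\!\int_{S^1} K\mathbf Z_t\cdot\phi + L\mathbf Z_x\cdot\phi - \nabla S(\mathbf Z)\cdot\phi \; dx\,dt = 0 \qquad \forall \phi\in D_q([0,T])\times C_p(S^1),$$ $$\mathbf Z(0,x) = \mathcal P_0\big(\mathbf z(0,x)\big),$$ where $\mathcal P_0$ is the $L_2$ projection into $C_p(S^1)$. For each $n=0,\dots,N-1$ let $\mathcal P$ denote the $L_2$ projection (in space-time, on $I_n\times S^1$) into $D_q(I_n)\times C_p(S^1)$, and define $$W := \nabla S(\mathbf Z)\cdot \mathcal P(\mathbf Z_x),$$ the momentum flux and density $$F^{m} = \tfrac12 \mathbf Z_t\cdot K\mathbf Z - S(\mathbf Z),\qquad G^{m} = \tfrac12 \mathbf Z_x\cdot K\mathbf Z,$$ and the energy flux and density $$F^{e} = \tfrac12 \mathbf Z_t\cdot L\mathbf Z,\qquad G^{e} = \tfrac12 \mathbf Z_x\cdot L\mathbf Z + S(\mathbf Z).$$ Then for every $n=0,\dots,N-1$ the discrete momentum law $$\int_{I_n}\int_{S^1} (G^{m})_t + \big(F^{m} + S(\mathbf Z)\big)_x - W \; dx\,dt = 0$$ and the discrete energy law $$\int_{I_n}\int_{S^1} (G^{e})_t + (F^{e})_x \; dx\,dt = 0$$ hold.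
   Context: Let $T>0$, let $S^1=[0,1)$ be the periodic unit interval, let $D\ge 2$ be an integer, let $K,L\in\mathbb R^{D\times D}$ be constant skew-symmetric matrices, and let $S:\mathbb R^D\to\mathbb R$ be continuously differentiable. The multisymplectic PDE being discretised is $K\mathbf z_t + L\mathbf z_x = \nabla S(\mathbf z)$ for $\mathbf z=\mathbf z(t,x)\in\mathbb R^D$, with initial data $\mathbf z(0,x)$ given in $L_2(S^1)^D$. The dot denotes the Euclidean inner product on $\mathbb R^D$. Meshes: $0=t_0<t_1<\dots<t_N=T$ with temporal elements $I_n=[t_n,t_{n+1})$, and $0=x_0<x_1<\dots<x_M=1$ with spatial elements $(x_m,x_{m+1})$, where $x_0$ and $x_M$ are identified by periodicity. Finite element spaces: for a partitioned one-dimensional domain $\Omega$, $D_r(\Omega)$ is the space of $\mathbb R^D$-valued functions whose restriction to each element is a polynomial of degree at most $r$ (in each component), with no continuity imposed between elements, and $C_r(\Omega)=D_r(\Omega)\cap (\mathcal C^0(\Omega))^D$ is the globally continuous subspace (for $\Omega=S^1$ continuity is periodic). $D_q(I_n)$ is the space of polynomials of degree at most $q$ on the single element $I_n$. The notation $X\times Y$ for a temporal space $X$ and a spatial space $Y$ denotes the tensor product finite element space, i.e. $\mathbb R^D$-valued functions of $(t,x)$ each component of which lies in the tensor product of the corresponding scalar temporal and spatial spaces. Here $q\ge 0$ and $p\ge 1$ are integers. Spatial and temporal derivatives of finite element functions are taken elementwise where necessary. *)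

(* Defs.v *)
From mathcomp Require Import all_boot all_order all_algebra.
From mathcomp Require Import all_classical all_reals all_analysis.

Set Implicit Arguments.
Unset Strict Implicit.
Unset Printing Implicit Defensive.

Import Order.TTheory GRing.Theory Num.Theory.
Import numFieldNormedType.Exports.

Local Open Scope classical_set_scope.
Local Open Scope ring_scope.

(* Functions on the periodic unit interval S^1 = [0,1) are represented by
   1-periodic functions on R; integrals over S^1 are integrals over [0,1).
   Spatial finite element functions are thus functions R -> 'cV[R]_D, and
   space-time functions are functions R -> R -> 'cV[R]_D of (t, x). *)

Section Calculus.
Context {R : realType} {D : nat}.
Implicit Types (u v z : 'cV[R]_D) (S : 'cV[R]_D -> R).

Definition dot u v : R := \sum_i u i 0 * v i 0.

Definition grad S z : 'cV[R]_D := \col_i 'D_(delta_mx i 0) S z.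

Definition continuously_differentiable S :=
  (forall z, differentiable S z) /\ continuous (grad S).

Definition skew_symmetric (A : 'M[R]_D) := A^T = - A.

(* Total pointwise derivatives.  For piecewise smooth functions they agree with
   the elementwise derivatives in the interior of every element; on the mesh
   points, a null set, their value is irrelevant to all integrals below. *)
Definition dt {V : normedModType R} (f : R -> R -> V) (t x : R) : V :=
  derive1 (fun s => f s x) t.

Definition dx {V : normedModType R} (f : R -> R -> V) (t x : R) : V :=
  derive1 (f t) x.

Definition circle : set R := `[0, 1[.

Definition space_integral (f : R -> R) : R :=
  \int[lebesgue_measure]_(x in circle) f x.

Definition spacetime_integral (I : set R) (f : R -> R -> R) : R :=
  \int[lebesgue_measure]_(t in I) space_integral (f t).

Definition L2_circle (f : R -> 'cV[R]_D) := forall i,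
  measurable_fun circle (fun x => f x i 0) /\
  lebesgue_measure.-integrable circle (fun x => (f x i 0 ^+ 2)%:E).

End Calculus.

Section FiniteElements.
Context {R : realType}.

Definition is_mesh (a b : R) (N : nat) (s : nat -> R) :=
  [/\ s 0%N = a, s N = b & forall n, (n < N)%N -> s n < s n.+1].

Definition time_elt (t : nat -> R) (n : nat) : set R := `[t n, t n.+1[.
Definition space_elt (x : nat -> R) (m : nat) : set R := `]x m, x m.+1[.

(* The spaces below are the scalar ones. *)

Definition poly_on (E : set R) (r : nat) : set (R -> R) :=
  [set v | exists2 p : {poly R},
     (size p <= r.+1)%N & forall s, E s -> v s = p.[s]].

Definition broken_space (elt : nat -> set R) (N r : nat) : set (R -> R) :=
  [set v | forall n, (n < N)%N -> poly_on (elt n) r v].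

Definition time_D (N : nat) (t : nat -> R) (r : nat) : set (R -> R) :=
  broken_space (time_elt t) N r.

Definition time_C (T : R) (N : nat) (t : nat -> R) (r : nat) : set (R -> R) :=
  time_D N t r `&` [set v | {within `[0, T], continuous v}].

Definition space_C (M : nat) (x : nat -> R) (r : nat) : set (R -> R) :=
  broken_space (space_elt x) M r `&`
  [set v | continuous v] `&` [set v | periodic v 1].

(* The R^D-valued functions all of whose components lie in Y. *)
Definition vector_space_of (D : nat) (Y : set (R -> R)) :
    set (R -> 'cV[R]_D) :=
  [set v | forall i, Y (fun x => v x i 0)].

(* X x Y on I x S^1: each component is a finite sum of products. *)
Definition tensor_space (D : nat) (I : set R) (X Y : set (R -> R)) :
    set (R -> R -> 'cV[R]_D) :=
  [set f | forall i, exists (k : nat) (a b : 'I_k -> R -> R),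
     (forall j, X (a j) /\ Y (b j)) /\
     forall t x, I t -> f t x i 0 = \sum_(j < k) a j t * b j x].

End FiniteElements.

Section Projection.
Context {R : realType} {D : nat}.

(* The g in V with <g, v> = <f, v> for all v in V; [get] picks one, and returns
   a default element if there is none. *)
Definition projection {E : pointedType} (ip : E -> E -> R) (V : set E) (f : E)
  : E := get [set g | V g /\ forall v, V v -> ip g v = ip f v].

Definition L2proj_space (V : set (R -> 'cV[R]_D)) (f : R -> 'cV[R]_D) :
    R -> 'cV[R]_D :=
  projection (fun g v => space_integral (fun x => dot (g x) (v x))) V f.

Definition L2proj_spacetime (I : set R) (V : set (R -> R -> 'cV[R]_D))
    (f : R -> R -> 'cV[R]_D) : R -> R -> 'cV[R]_D :=
  projection
    (fun g v => spacetime_integral I (fun t x => dot (g t x) (v t x))) V f.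

End Projection.

Section Densities.
Context {R : realType} {D : nat}.
Variables (K L : 'M[R]_D) (S : 'cV[R]_D -> R) (Z : R -> R -> 'cV[R]_D).

Definition momentum_flux (t x : R) : R :=
  2^-1 * dot (dt Z t x) (K *m Z t x) - S (Z t x).

Definition momentum_density (t x : R) : R :=
  2^-1 * dot (dx Z t x) (K *m Z t x).

Definition energy_flux (t x : R) : R :=
  2^-1 * dot (dt Z t x) (L *m Z t x).

Definition energy_density (t x : R) : R :=
  2^-1 * dot (dx Z t x) (L *m Z t x) + S (Z t x).

End Densities.

Section Method.
Context {R : realType} {D : nat}.
Variables (K L : 'M[R]_D) (S : 'cV[R]_D -> R) (T : R).
Variables (N : nat) (t_ : nat -> R) (M : nat) (x_ : nat -> R) (q p : nat).

Definition fem_solution (z0 : R -> 'cV[R]_D) (Z : R -> R -> 'cV[R]_D) :=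
  [/\ tensor_space `[0, T] (time_C T N t_ q.+1) (space_C M x_ p) Z,
      forall phi : R -> R -> 'cV[R]_D,
        tensor_space `[0, T] (time_D N t_ q) (space_C M x_ p) phi ->
        spacetime_integral `[0, T] (fun t x =>
          dot (K *m dt Z t x) (phi t x) + dot (L *m dx Z t x) (phi t x)
          - dot (grad S (Z t x)) (phi t x)) = 0
    & Z 0 = L2proj_space (vector_space_of (space_C M x_ p)) z0].

(* The projection of Z_x into D_q(I_n) x C_p(S^1). *)
Definition proj_dx (Z : R -> R -> 'cV[R]_D) (n : nat) : R -> R -> 'cV[R]_D :=
  let I := time_elt t_ n in
  L2proj_spacetime I (tensor_space I (poly_on I q) (space_C M x_ p)) (dx Z).

Definition momentum_W (Z : R -> R -> 'cV[R]_D) (n : nat) (t x : R) : R :=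
  dot (grad S (Z t x)) (proj_dx Z n t x).

End Method.

(* Main.v *)
Require Import Defs.
From mathcomp Require Import all_boot all_order all_algebra.
From mathcomp Require Import all_classical all_reals all_analysis.
From mathcomp Require Import measurable_realfun ring lra.
Import Order.TTheory GRing.Theory Num.Theory.
Import numFieldNormedType.Exports.
Local Open Scope classical_set_scope.
Local Open Scope ring_scope.

(** The laws are local in time, so everything happens on one time element
    [I_n].  Inside a cell of the mesh the solution is a bivariate polynomial, and
    both flux laws reduce there to the product rule and the chain rule.  For a
    constant matrix [A], half of the [t]-derivative of [Z_x . A Z] plus half of
    the [x]-derivative of [Z_t . A Z] is [Z_tx . A Z] when [A] is skew, because
    the terms [Z_x . A Z_t] and [Z_t . A Z_x] cancel.  On the other hand
    [Z_tx . A Z + Z_t . A Z_x] is the [x]-derivative of [Z_t . A Z], which is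
    continuous and periodic in [x], so its integral over the circle vanishes
    ([spacetime_integral_dx_eq0]); the elementwise polynomials glue because [Z]
    and [Z_t] are continuous across spatial nodes.

    The method may be tested with functions that vanish outside [I_n], as the
    test space is discontinuous in time ([fem_solution_element]).

    Energy ([energy_law], [A = L]): [Z_t] has degree [q] in time, hence is a
    legitimate test function.  The residual tested with [Z_t] loses the term
    [K Z_t . Z_t], and what remains is minus the integrand of the law up to the
    exact [x]-derivative above.

    Momentum ([momentum_law], [A = K]): [Z_x] is not a legitimate test function,
    since it is discontinuous in space and has degree [q + 1] in time; its
    projection [P] is.  In the residual tested with [P], the term
    [K Z_t . P] may be replaced by [K Z_t . Z_x], because [K Z_t] lies in the
    space onto which one projects, and [L Z_x . P] integrates to
    [- P . L P = 0], because [L P] lies in it too.  What is left is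
    [K Z_t . Z_x - grad S . P], which differs from the integrand of the law by
    the exact [x]-derivative above.

    Two ingredients are needed to make this rigorous.  Iterated integrals have
    to be additive, which is obtained from the class [cellwise_continuous] of
    functions that agree on every open cell with a jointly continuous function
    of [(t, x)]; it contains all integrands, including those with the gradient
    of [S].  And the projection has to exist ([L2proj_spacetimeP]); this is
    a Gram-Schmidt argument along the point evaluations that determine a
    discrete function ([exists_projection], [tensor_sample_eq0]). *)

Set Implicit Arguments.
Unset Strict Implicit.
Unset Printing Implicit Defensive.

(** * Derivatives of vector-valued functions *)

Section DotProduct.
Context {R : realType} {D : nat}.
Implicit Types (u v : 'cV[R]_D) (A : 'M[R]_D).

Lemma dotC (u v : 'cV[R]_D) : dot u v = dot v u.
Proof. by apply: eq_bigr => i _; rewrite mulrC. Qed.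

Lemma dotDl (u v w : 'cV[R]_D) : dot (u + v) w = dot u w + dot v w.
Proof. by rewrite /dot -big_split; apply: eq_bigr => i _; rewrite mxE mulrDl. Qed.

Lemma dotZl c (u v : 'cV[R]_D) : dot (c *: u) v = c * dot u v.
Proof. by rewrite /dot mulr_sumr; apply: eq_bigr => i _; rewrite mxE mulrA. Qed.

Lemma dot0r (u : 'cV[R]_D) : dot u 0 = 0.
Proof. by rewrite /dot big1// => i _; rewrite mxE mulr0. Qed.

(** Moving [A] across the dot product transposes it. *)
Lemma dot_mulmx_skew A u v : skew_symmetric A ->
  dot u (A *m v) = - dot v (A *m u).
Proof.
move=> hA; rewrite /dot -sumrN.
under eq_bigr do rewrite mxE mulr_sumr.
rewrite exchange_big; apply: eq_bigr => j _.
rewrite mxE mulr_sumr -sumrN; apply: eq_bigr => i _.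
have /matrixP/(_ i j) := hA; rewrite !mxE => ->.
by ring.
Qed.

Lemma dot_mulmx_self A u : skew_symmetric A -> dot u (A *m u) = 0.
Proof. by move=> hA; have := dot_mulmx_skew u u hA; lra. Qed.

Lemma continuous_dot (T : topologicalType) (f g : T -> 'cV[R]_D) :
  (forall i, continuous (fun z => f z i 0)) ->
  (forall i, continuous (fun z => g z i 0)) ->
  continuous (fun z => dot (f z) (g z)).
Proof.
move=> cf cg; apply: continuous_big => [|i _]; first exact: add_continuous.
by move=> z; apply: cvgM; [exact: cf|exact: cg].
Qed.

End DotProduct.

Section PointwiseDerivatives.
Context {R : realType}.
Implicit Types (f g : R -> R) (x : R).

Lemma is_derive_eq_itv (V : normedModType R) (f g : R -> V) a b x df :
  x \in `]a, b[ -> (forall y, y \in `]a, b[ -> f y = g y) ->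
  is_derive x 1 g df -> is_derive x 1 f df.
Proof.
move=> xab fg; apply: near_eq_is_derive.
by near do (apply/esym/fg); exact: near_in_itvoo.
Unshelve. all: by end_near. Qed.

Lemma is_derive_mul f g x df dg : is_derive x 1 f df -> is_derive x 1 g dg ->
  is_derive x 1 (fun y => f y * g y) (df * g x + f x * dg).
Proof.
move=> Hf Hg; have := is_deriveM Hf Hg.
by rewrite [f x *: dg + _]addrC /GRing.scale /= [g x * _]mulrC.
Qed.

Lemma is_derive_scale c f x df : is_derive x 1 f df ->
  is_derive x 1 (fun y => c * f y) (c * df).
Proof. exact: is_deriveZ. Qed.

Lemma is_derive_sumE n (h : 'I_n -> R -> R) x (dh : 'I_n -> R) :
  (forall i, is_derive x 1 (h i) (dh i)) ->
  is_derive x 1 (fun y => \sum_(i < n) h i y) (\sum_(i < n) dh i).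
Proof. by move=> /is_derive_sum; rewrite fct_sumE. Qed.

Lemma derive1_is_derive (V : normedModType R) (f : R -> V) x df :
  is_derive x 1 f df -> derive1 f x = df.
Proof. by move=> Hf; rewrite derive1E derive_val. Qed.

Context {D : nat}.
Implicit Types (u v : R -> 'cV[R]_D).

(** Componentwise derivatives; [du] is the candidate value, so that no
    derivability has to be carried separately. *)
Definition col_derive x u (du : 'cV[R]_D) :=
  forall i, is_derive x 1 (fun y => u y i 0) (du i 0).

Lemma col_derive1 u x du : col_derive x u du -> is_derive x 1 u du.
Proof.
move=> Hu; have du1 : derivable u x 1.
  by apply/derivable_mxP => i j; rewrite ord1; have [] := Hu i.
apply: DeriveDef => //; rewrite derive_mx//; apply/colP => i; rewrite mxE.
by have [] := Hu i.
Qed.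

Lemma col_derive_dot u v x du dv : col_derive x u du -> col_derive x v dv ->
  is_derive x 1 (fun y => dot (u y) (v y)) (dot du (v x) + dot (u x) dv).
Proof.
move=> Hu Hv; rewrite /dot -big_split /=.
by apply: is_derive_sumE => i; exact: is_derive_mul.
Qed.

Lemma col_derive_mulmx (A : 'M[R]_D) u x du : col_derive x u du ->
  col_derive x (fun y => A *m u y) (A *m du).
Proof.
move=> Hu i; rewrite mxE.
rewrite (_ : (fun y => _) = fun y => \sum_j A i j * u y j 0).
  by apply: is_derive_sumE => j; exact: is_derive_scale.
by apply/funext => y; rewrite mxE.
Qed.

(** Chain rule: the differential of [S] is linear, hence is determined by
    the partial derivatives collected in [grad S]. *)
Lemma is_derive_grad (S : 'cV[R]_D -> R) u x du :
  differentiable S (u x) -> col_derive x u du ->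
  is_derive x 1 (fun y => S (u y)) (dot (grad S (u x)) du).
Proof.
move=> dS /col_derive1 Hu.
have du1 : differentiable u x by apply/derivable1_diffP; case: Hu.
have dSu : differentiable (S \o u) x by exact: differentiable_comp.
apply: DeriveDef; first exact/derivable1_diffP.
rewrite -[LHS]/('D_1 (S \o u) x) deriveE// diff_comp//=.
have -> : 'd u x 1 = du by rewrite -deriveE// derive_val.
have {1}-> : du = \sum_i du i 0 *: delta_mx i 0.
  rewrite [LHS]matrix_sum_delta; apply: eq_bigr => i _.
  by rewrite big_ord1.
rewrite linear_sum /dot; apply: eq_bigr => i _.
by rewrite linearZ mxE /= deriveE// mulrC.
Qed.

End PointwiseDerivatives.

(** * Integrals of piecewise continuous functions *)

Section OneElement.
Context {R : realType}.
Notation mu := (@lebesgue_measure R).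
Implicit Types (f g : R -> R) (a b : R).

Lemma continuous_integrable_itv g a b :
  continuous g -> mu.-integrable `[a, b] (EFin \o g).
Proof.
move=> cg; apply: continuous_compact_integrable; first exact: segment_compact.
exact: continuous_subspaceT.
Qed.

(** The values of [f] at the endpoints are arbitrary, as those of an
    elementwise derivative are; only the null set [{a}] has to be added to the
    open element. *)
Lemma integrable_eq_on_element f g a b : continuous g ->
  (forall x, x \in `]a, b[ -> f x = g x) ->
  mu.-integrable `[a, b[ (EFin \o f).
Proof.
move=> cg fg.
have int_oo : mu.-integrable `]a, b[ (EFin \o f).
  apply: (@eq_integrable _ _ _ mu `]a, b[%classic (measurable_itv _)
            (EFin \o g)).
    by move=> x /[!inE] /fg /= ->.
  apply: (@integrableS _ _ _ mu `[a, b]) => //; try exact: measurable_itv.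
    by apply: subset_itv; rewrite bnd_simp.
  exact: continuous_integrable_itv.
have [ab|ba] := ltP a b; last first.
  by rewrite set_itv_ge -?leNgt ?bnd_simp//; exact: integrable_set0.
have -> : `[a, b[%classic = [set a] `|` `]a, b[%classic by rewrite setU1itv.
apply/(@negligible_integrable _ _ _ mu _ [set a]) => //.
- exact: measurableU.
- apply/measurable_funU => //; split; first exact: measurable_fun_set1.
  exact: measurable_int int_oo.
- exact: lebesgue_measure_set1.
- apply: (@integrableS _ _ _ mu `]a, b[) => //.
    by apply: measurableD => //; apply: measurableU.
  by move=> x [[xa|//] nxa]; case: nxa.
Qed.

Lemma Rintegral_eq_on_element f g a b : continuous g ->
  (forall x, x \in `]a, b[ -> f x = g x) ->
  \int[mu]_(x in `[a, b[) f x = \int[mu]_(x in `[a, b]) g x.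
Proof.
move=> cg fg.
have intf := integrable_eq_on_element cg fg.
have intg := integrable_eq_on_element cg (fun x (_ : x \in `]a, b[) => erefl).
rewrite -(@Rintegral_itv_bndo_bndc _ (BLeft a) b g) //.
(* Both integrals are compared on the open element, where [f] and [g] agree. *)
have oo h : mu.-integrable `[a, b[ (EFin \o h) ->
    mu.-integrable `]a, b[ (EFin \o h).
  by apply: integrableS => //; apply: subset_itv; rewrite bnd_simp.
rewrite -!(@Rintegral_itv_obnd_cbnd _ a (BLeft b)); [|exact: oo..].
by apply: eq_Rintegral => x /[!inE] /fg.
Qed.

End OneElement.

Lemma integrable_setU_disjoint d (T : measurableType d) (R : realType)
    (mu : {measure set T -> \bar R}) (A B : set T) (f : T -> \bar R) :
  measurable A -> measurable B -> [disjoint A & B] ->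
  mu.-integrable A f -> mu.-integrable B f -> mu.-integrable (A `|` B) f.
Proof.
move=> mA mB AB /integrableP[mfA fA] /integrableP[mfB fB].
have mU := (measurable_funU _ mA mB).2 (conj mfA mfB).
apply/integrableP; split=> //; rewrite integral_setU//; first exact: lte_add_pinfty.
exact: (measurableT_comp (@measurable_realfun.abse_measurable R setT) mU).
Qed.

Section Mesh.
Context {R : realType}.
Notation mu := (@lebesgue_measure R).
Implicit Types (f g : R -> R) (s : nat -> R).

Lemma mesh_le a b N s i j : is_mesh a b N s ->
  (i <= j <= N)%N -> s i <= s j.
Proof.
move=> [_ _ ls] /andP[ij jN]; elim: j ij jN => [|j IH].
  by rewrite leqn0 => /eqP ->.
rewrite leq_eqVlt => /predU1P[->//|ij jN].
by rewrite (le_trans (IH ij (ltnW jN)))// ltW// ls.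
Qed.

(** Each piece extends continuously to the whole line, so that it is
    bounded up to the ends of its element. *)
Definition piecewise_continuous N s f := forall m, (m < N)%N ->
  exists2 g, continuous g & forall x, space_elt s m x -> f x = g x.

(** Induction on the number of elements, adding one half-open element
    at a time. *)
Lemma piecewise_continuous_integral a b N s f : is_mesh a b N s ->
  piecewise_continuous N s f ->
  mu.-integrable `[a, b[ (EFin \o f) /\
  \int[mu]_(x in `[a, b[) f x =
    \sum_(m < N) \int[mu]_(x in `[s m, s m.+1[) f x.
Proof.
move=> ms cf; have [<- <- ls] := ms.
suff: forall k, (k <= N)%N -> mu.-integrable `[s 0%N, s k[ (EFin \o f) /\
    \int[mu]_(x in `[s 0%N, s k[) f x =
    \sum_(m < k) \int[mu]_(x in `[s m, s m.+1[) f x by apply.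
elim=> [_|k IH kN].
  rewrite set_itvco0 big_ord0 Rintegral_set0.
  by split=> //; exact: integrable_set0.
have [intk Ek] := IH (ltnW kN).
have sk : s 0%N <= s k by rewrite (mesh_le ms)// (ltnW kN).
have U : `[s 0%N, s k.+1[%classic =
    `[s 0%N, s k[%classic `|` `[s k, s k.+1[%classic.
  by apply: itv_bndbnd_setU; rewrite bnd_simp// ltW// ls.
have [g cg fg] := cf k kN.
have int1 : mu.-integrable `[s k, s k.+1[ (EFin \o f).
  by apply: (integrable_eq_on_element cg) => x xk; exact: fg.
have dis : [disjoint `[s 0%N, s k[%classic & `[s k, s k.+1[%classic].
  apply/disj_setPS => y [/=]; rewrite 2!in_itv/= => /andP[_ yx] /andP[].
  by rewrite leNgt yx.
have intU : mu.-integrable (`[s 0%N, s k[ `|` `[s k, s k.+1[) (EFin \o f).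
  exact: integrable_setU_disjoint.
by rewrite U; split=> //; rewrite Rintegral_setU// Ek big_ord_recr.
Qed.

End Mesh.

Section PeriodicFTC.
Context {R : realType} (M : nat) (x_ : nat -> R).
Hypothesis hx : is_mesh 0 1 M x_.
Notation mu := (@lebesgue_measure R).

(** Fundamental theorem of calculus on every element; the boundary terms
    telescope because [w] is continuous at the nodes, and the two that remain
    agree by periodicity. *)
Lemma space_integral_derive (w dw : R -> R) :
  continuous w -> w 1 = w 0 -> piecewise_continuous M x_ dw ->
  (forall m x, (m < M)%N -> space_elt x_ m x -> is_derive x 1 w (dw x)) ->
  space_integral dw = 0.
Proof.
move=> cw w10 cdw Dw.
rewrite /space_integral (piecewise_continuous_integral hx cdw).2.
have [x0 xM lx] := hx.
rewrite (eq_bigr (fun m : 'I_M => w (x_ m.+1) - w (x_ m))).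
  rewrite -(big_mkord xpredT (fun m => w (x_ m.+1) - w (x_ m))) telescope_sumr//.
  by rewrite xM x0 w10 subrr.
move=> m _; have [g cg dg] := cdw m (ltn_ord m).
rewrite (Rintegral_eq_on_element cg)//.
rewrite /Rintegral (@continuous_FTC2 _ g w) //; first exact: lx.
- exact: continuous_subspaceT.
- split.
  + by move=> x xm; have [] := Dw m x (ltn_ord m) xm.
  + by apply: cvg_at_right_filter; exact: cw.
  + by apply: cvg_at_left_filter; exact: cw.
- move=> x xm; rewrite -(dg x xm); apply: derive1_is_derive.
  exact: (Dw m x (ltn_ord m)).
Qed.

End PeriodicFTC.

(** * Cellwise continuous functions and their space-time integrals *)

Lemma subset_itv_oo_co (R : realType) (a b t : R) :
  t \in `]a, b[ -> `[a, b[%classic t.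
Proof. by apply: subset_itv; rewrite bnd_simp. Qed.

Section ParametricIntegral.
Context {R : realType}.
Notation mu := (@lebesgue_measure R).

Lemma continuous_slice (g : R * R -> R) t :
  continuous g -> continuous (fun x => g (t, x)).
Proof.
move=> cg x; apply: (@continuous_comp _ _ _ (fun x : R => (t, x)) g); last exact: cg.
exact: (cvg_pair (cvg_cst t) cvg_id).
Qed.

Lemma continuous_slice_l (g : R * R -> R) x :
  continuous g -> continuous (fun t => g (t, x)).
Proof.
move=> cg t; apply: (@continuous_comp _ _ _ (fun t : R => (t, x)) g); last exact: cg.
exact: (cvg_pair cvg_id (cvg_cst x)).
Qed.

(** Dominated convergence: [g] is bounded on the compact rectangle
    [[t - 1, t + 1] x [a, b]]. *)
Lemma continuous_parametric_integral (g : R * R -> R) (a b : R) :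
  continuous g -> continuous (fun t => \int[mu]_(x in `[a, b]) g (t, x)).
Proof.
move=> cg t.
have /compact_bounded [C [_ gC]] : compact (g @` (`[t - 1, t + 1] `*` `[a, b])).
  apply: continuous_compact; first exact: continuous_subspaceT.
  by apply: compact_setX; exact: segment_compact.
have := @continuity_under_integral R _ _ mu (fun t x => g (t, x)) `[a, b]%classic
  (measurable_itv _) (t - 1) (t + 1).
move=> /(_ _ _ (cst (C + 1)) _ _ t); apply.
- by move=> s _; apply: continuous_integrable_itv; exact: continuous_slice.
- by apply: aeW => x _ s _; exact: continuous_slice_l.
- exact: (continuous_integrable_itv _ _ (fun=> cvg_cst _)).
- move=> s st; apply: aeW => x xab; apply: (gC (C + 1)).
    by rewrite ltrDl.
  exists (s, x) => //; split=> //=.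
  by move: st; apply: subset_itv; rewrite bnd_simp.
- by rewrite inE /= in_itv /= ltrBlDr ltrDl ltr01.
Qed.

End ParametricIntegral.

Section CellwiseContinuous.
Context {R : realType} (a b : R) (M : nat) (x_ : nat -> R).
Notation mu := (@lebesgue_measure R).
Implicit Types (f g : R -> R -> R).

(** One element [[a, b[] in time and all elements of the circle.  Joint
    continuity of the pieces, on the whole plane, is what makes the inner
    integral a continuous function of [t] up to the ends of the time element. *)
Definition cellwise_continuous f := forall m, (m < M)%N ->
  exists2 g : R * R -> R, continuous g &
  forall t x, t \in `]a, b[ -> space_elt x_ m x -> f t x = g (t, x).

Lemma cellwise_eq f g :
  (forall m t x, (m < M)%N -> t \in `]a, b[ -> space_elt x_ m x ->
    f t x = g t x) ->
  cellwise_continuous g -> cellwise_continuous f.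
Proof.
move=> fg cg m mM; have [h ch gh] := cg m mM.
by exists h => // t x tab xm; rewrite (fg m)// gh.
Qed.

Lemma cellwise_cst c : cellwise_continuous (fun _ _ => c).
Proof. by move=> m _; exists (fun=> c) => //; move=> z; exact: cvg_cst. Qed.

Lemma cellwiseD f g : cellwise_continuous f -> cellwise_continuous g ->
  cellwise_continuous (fun t x => f t x + g t x).
Proof.
move=> cf cg m mM; have [f' cf' ff'] := cf m mM; have [g' cg' gg'] := cg m mM.
exists (fun z => f' z + g' z); first by move=> z; apply: cvgD; [exact: cf'|exact: cg'].
by move=> t x tab xm; rewrite ff'// gg'.
Qed.

Lemma cellwiseM f g : cellwise_continuous f -> cellwise_continuous g ->
  cellwise_continuous (fun t x => f t x * g t x).
Proof.
move=> cf cg m mM; have [f' cf' ff'] := cf m mM; have [g' cg' gg'] := cg m mM.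
exists (fun z => f' z * g' z); first by move=> z; apply: cvgM; [exact: cf'|exact: cg'].
by move=> t x tab xm; rewrite ff'// gg'.
Qed.

Lemma cellwise_sum (I : Type) (r : seq I) (P : pred I) (F : I -> R -> R -> R) :
  (forall i, cellwise_continuous (F i)) ->
  cellwise_continuous (fun t x => \sum_(i <- r | P i) F i t x).
Proof.
move=> cF; elim: r => [|i r IH].
  by apply: cellwise_eq (cellwise_cst 0) => *; rewrite big_nil.
case Pi: (P i); last first.
  by apply: cellwise_eq IH => *; rewrite big_cons Pi.
by apply: cellwise_eq (cellwiseD (cF i) IH) => *; rewrite big_cons Pi.
Qed.

Lemma cellwise_slice f t : t \in `]a, b[ -> cellwise_continuous f ->
  piecewise_continuous M x_ (f t).
Proof.
move=> tab cf m mM; have [g cg fg] := cf m mM.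
exists (fun x => g (t, x)); first exact: continuous_slice.
by move=> x xm; exact: fg.
Qed.

Hypothesis hx : is_mesh 0 1 M x_.

Lemma space_integralD (u v : R -> R) : piecewise_continuous M x_ u ->
  piecewise_continuous M x_ v ->
  space_integral (fun x => u x + v x) = space_integral u + space_integral v.
Proof.
move=> pu pv; apply: RintegralD; first exact: measurable_itv.
- exact: (piecewise_continuous_integral hx pu).1.
- exact: (piecewise_continuous_integral hx pv).1.
Qed.

Lemma space_integralZ c (u : R -> R) : piecewise_continuous M x_ u ->
  space_integral (fun x => c * u x) = c * space_integral u.
Proof.
by move=> pu; apply: RintegralZl;
  [exact: measurable_itv|exact: (piecewise_continuous_integral hx pu).1].
Qed.

Lemma space_integral0 : space_integral (fun _ : R => 0) = 0.
Proof.
rewrite -[RHS](mul0r (space_integral (fun _ : R => 0))) -space_integralZ ?mul0r//.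
by move=> m _; exists (fun=> 0) => // z; exact: cvg_cst.
Qed.

Lemma space_integral_eq (u v : R -> R) : piecewise_continuous M x_ v ->
  (forall m x, (m < M)%N -> space_elt x_ m x -> u x = v x) ->
  space_integral u = space_integral v.
Proof.
move=> pv uv.
have pu : piecewise_continuous M x_ u.
  by move=> m mM; have [g cg vg] := pv m mM; exists g => // x xm; rewrite (uv m)// vg.
rewrite /space_integral (piecewise_continuous_integral hx pu).2.
rewrite (piecewise_continuous_integral hx pv).2.
apply: eq_bigr => m _; have [g cg vg] := pv m (ltn_ord m).
rewrite (Rintegral_eq_on_element cg); last first.
  by move=> x xm; rewrite (uv m)//; exact: vg.
by rewrite (Rintegral_eq_on_element cg)// => x xm; exact: vg.
Qed.

(** This gives integrability in [t], hence the additivity of iterated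
    integrals. *)
Lemma cellwise_space_integral f : cellwise_continuous f ->
  exists2 h : R -> R, continuous h &
  forall t, t \in `]a, b[ -> space_integral (f t) = h t.
Proof.
move=> cf.
have /choice [g gP] : forall m : 'I_M, exists g : R * R -> R, continuous g /\
    forall t x, t \in `]a, b[ -> space_elt x_ m x -> f t x = g (t, x).
  by move=> m; have [g] := cf m (ltn_ord m); exists g.
exists (fun t => \sum_(m < M) \int[mu]_(x in `[x_ m, x_ m.+1]) g m (t, x)).
  apply: continuous_big => [|m _]; first exact: add_continuous.
  apply: continuous_parametric_integral.
  exact: (gP m).1.
move=> t tab; rewrite /space_integral.
rewrite (piecewise_continuous_integral hx (cellwise_slice tab cf)).2.
apply: eq_bigr => m _; apply: Rintegral_eq_on_element.
  by apply: continuous_slice; exact: (gP m).1.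
by move=> x xm; apply: (gP m).2.
Qed.

Notation J := (spacetime_integral `[a, b[%classic).

(** Used when two integrands have equal integrals over the circle for
    each time, without being equal. *)
Lemma spacetime_integral_eq_slice f g : cellwise_continuous g ->
  (forall t, t \in `]a, b[ -> space_integral (f t) = space_integral (g t)) ->
  J f = J g.
Proof.
move=> /cellwise_space_integral [h ch gh] fg.
rewrite /spacetime_integral (Rintegral_eq_on_element ch); last first.
  by move=> t tab; rewrite fg// gh.
by rewrite (Rintegral_eq_on_element ch).
Qed.

Lemma spacetime_integral_eq f g : cellwise_continuous g ->
  (forall m t x, (m < M)%N -> t \in `]a, b[ -> space_elt x_ m x ->
    f t x = g t x) ->
  J f = J g.
Proof.
move=> cg fg; apply: spacetime_integral_eq_slice => // t tab.
apply: space_integral_eq; first exact: cellwise_slice.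
by move=> m x mM xm; rewrite (fg m).
Qed.

Lemma spacetime_integralD f g :
  cellwise_continuous f -> cellwise_continuous g ->
  J (fun t x => f t x + g t x) = J f + J g.
Proof.
move=> cf cg.
have [h ch fh] := cellwise_space_integral cf.
have [k ck gk] := cellwise_space_integral cg.
rewrite /spacetime_integral -RintegralD//; first last.
- exact: (integrable_eq_on_element ck).
- exact: (integrable_eq_on_element ch).
have chk : continuous (fun t => h t + k t).
  by move=> t; apply: cvgD; [exact: ch|exact: ck].
rewrite !(Rintegral_eq_on_element chk)// => t tab.
  by rewrite fh// gk.
rewrite space_integralD ?fh ?gk//; exact: cellwise_slice.
Qed.

Lemma spacetime_integralZ c f : cellwise_continuous f ->
  J (fun t x => c * f t x) = c * J f.
Proof.
move=> cf; have [h ch fh] := cellwise_space_integral cf.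
rewrite /spacetime_integral -RintegralZl//; last exact: (integrable_eq_on_element ch).
have chc : continuous (fun t => c * h t).
  by move=> t; apply: cvgM; [exact: cvg_cst|exact: ch].
rewrite !(Rintegral_eq_on_element chc)// => t tab; first by rewrite fh.
rewrite space_integralZ ?fh//; exact: cellwise_slice.
Qed.

Lemma spacetime_integral0 : J (fun _ _ => 0) = 0.
Proof.
rewrite -[RHS](mul0r (J (fun _ _ => 0))) -spacetime_integralZ ?mul0r//.
exact: cellwise_cst.
Qed.

Lemma spacetime_integral_ge0 f : (forall t x, 0 <= f t x) -> 0 <= J f.
Proof. by move=> f0; apply: Rintegral_ge0 => t _; exact: Rintegral_ge0. Qed.

End CellwiseContinuous.

(** * Tensor products of polynomials in time and finite elements in space *)

Section FETensor.
Context {R : realType} (a b : R) (M : nat) (x_ : nat -> R) (p : nat).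
Implicit Types (f g w : R -> R -> R).
Notation cw := (cellwise_continuous a b M x_).

(** A scalar component of a member of the tensor space, with its temporal
    factors replaced by the polynomials that they are on the element, so that
    they can be differentiated symbolically. *)
Definition fe_tensor r w := exists k (A : 'I_k -> {poly R}) (B : 'I_k -> R -> R),
  (forall j, (size (A j) <= r.+1)%N /\ space_C M x_ p (B j)) /\
  forall t x, `[a, b[%classic t -> w t x = \sum_(j < k) (A j).[t] * B j x.

Lemma tensor_spaceP D r (f : R -> R -> 'cV[R]_D) :
  tensor_space `[a, b[%classic (poly_on `[a, b[%classic r) (space_C M x_ p) f <->
  forall i, fe_tensor r (fun t x => f t x i 0).
Proof.
split=> H i; have [k [A [B [HAB HE]]]] := H i; last first.
  exists k, (fun j => horner (A j)), B; split=> // j; split; last exact: (HAB j).2.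
  by exists (A j) => //; exact: (HAB j).1.
have /choice [A' HA'] : forall j, exists P : {poly R}, (size P <= r.+1)%N /\
    forall s, `[a, b[%classic s -> A j s = P.[s].
  by move=> j; have [P] := (HAB j).1; exists P.
exists k, A', B; split=> [j|t x tab].
  by split; [exact: (HA' j).1|exact: (HAB j).2].
by rewrite HE//; apply: eq_bigr => j _; rewrite (HA' j).2.
Qed.

Lemma fe_tensor_eq r f g : (forall t x, `[a, b[%classic t -> f t x = g t x) ->
  fe_tensor r g -> fe_tensor r f.
Proof.
move=> fg [k [A [B [HAB HE]]]]; exists k, A, B; split=> // t x tab.
by rewrite fg// HE.
Qed.

Lemma fe_tensor0 r : fe_tensor r (fun _ _ => 0).
Proof.
exists 0%N, (fun=> 0), (fun=> cst 0); split=> [[]//|t x _].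
by rewrite big_ord0.
Qed.

Lemma fe_tensorD r f g : fe_tensor r f -> fe_tensor r g ->
  fe_tensor r (fun t x => f t x + g t x).
Proof.
move=> [k [A [B [HAB HE]]]] [k' [A' [B' [HAB' HE']]]].
exists (k + k')%N,
  (fun j => match fintype.split j with inl i => A i | inr i => A' i end),
  (fun j => match fintype.split j with inl i => B i | inr i => B' i end).
split=> [j|t x tab]; first by case: (fintype.split j).
rewrite HE// HE'// big_split_ord /=; congr (_ + _); apply: eq_bigr => j _.
  by rewrite (unsplitK (inl j)).
by rewrite (unsplitK (inr j)).
Qed.

Lemma fe_tensorZ r c f : fe_tensor r f -> fe_tensor r (fun t x => c * f t x).
Proof.
move=> [k [A [B [HAB HE]]]]; exists k, (fun j => c *: A j), B.
split=> [j|t x tab].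
  split; last exact: (HAB j).2.
  exact: leq_trans (size_scale_leq _ _) (HAB j).1.
by rewrite HE// mulr_sumr; apply: eq_bigr => j _; rewrite hornerZ mulrA.
Qed.

Lemma fe_tensor_sum r n (F : 'I_n -> R -> R -> R) :
  (forall i, fe_tensor r (F i)) ->
  fe_tensor r (fun t x => \sum_(i < n) F i t x).
Proof.
move=> HF; elim: (index_enum _) => [|i s IH].
  by apply: fe_tensor_eq (fe_tensor0 r) => *; rewrite big_nil.
by apply: fe_tensor_eq (fe_tensorD (HF i) IH) => *; rewrite big_cons.
Qed.

Lemma cellwise_time (h : R -> R) : continuous h -> cw (fun t _ => h t).
Proof.
move=> ch m mM; exists (fun z => h z.1) => //.
by move=> z; apply: (@continuous_comp _ _ _ fst h); [exact: cvg_fst|exact: ch].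
Qed.

Lemma cellwise_space (h : R -> R) : piecewise_continuous M x_ h ->
  cw (fun _ x => h x).
Proof.
move=> ch m mM; have [g cg hg] := ch m mM; exists (fun z => g z.2).
  by move=> z; apply: (@continuous_comp _ _ _ snd g); [exact: cvg_snd|exact: cg].
by move=> t x _; exact: hg.
Qed.

Lemma space_C_piecewise (B : R -> R) : space_C M x_ p B ->
  piecewise_continuous M x_ B.
Proof. by move=> [[_ cB] _] m _; exists B. Qed.

Lemma space_C_is_derive (B : R -> R) m x : space_C M x_ p B -> (m < M)%N ->
  space_elt x_ m x -> is_derive x 1 B (derive1 B x).
Proof.
move=> [[BP _] _] mM xm; have [P _ PB] := BP m mM.
have dB : is_derive x 1 B (P^`()).[x].
  by apply: is_derive_eq_itv (is_derive_poly P x); [exact: xm|exact: PB].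
by rewrite (derive1_is_derive dB).
Qed.

Lemma space_C_derive1 (B : R -> R) : space_C M x_ p B ->
  piecewise_continuous M x_ (derive1 B).
Proof.
move=> [[BP _] _] m mM; have [P _ PB] := BP m mM.
exists (horner P^`()); first exact: continuous_horner.
move=> x xm; apply: derive1_is_derive.
by apply: is_derive_eq_itv (is_derive_poly P x); [exact: xm|exact: PB].
Qed.

Lemma fe_tensor_cellwise r w : fe_tensor r w -> cw w.
Proof.
move=> [k [A [B [HAB HE]]]].
apply: (@cellwise_eq _ _ _ _ _ _ (fun t x => \sum_(j < k) (A j).[t] * B j x)).
  by move=> m t x _ /subset_itv_oo_co tab _; exact: HE.
apply: cellwise_sum => j; apply: cellwiseM.
  by apply: cellwise_time; exact: continuous_horner.
by apply: cellwise_space; apply: space_C_piecewise; exact: (HAB j).2.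
Qed.

Lemma fe_tensor_continuous r w t : `[a, b[%classic t -> fe_tensor r w ->
  continuous (w t).
Proof.
move=> tab [k [A [B [HAB HE]]]].
rewrite (_ : w t = fun x => \sum_(j < k) (A j).[t] * B j x); last first.
  by apply/funext => x; rewrite HE.
apply: continuous_big => [|j _]; first exact: add_continuous.
move=> x; apply: cvgM; first exact: cvg_cst.
by have [[_ cB] _] := (HAB j).2; exact: cB.
Qed.

Lemma fe_tensor_periodic r w t x : `[a, b[%classic t -> fe_tensor r w ->
  w t (x + 1) = w t x.
Proof.
move=> tab [k [A [B [HAB HE]]]]; rewrite !HE//; apply: eq_bigr => j _.
by have [_ pB] := (HAB j).2; rewrite pB.
Qed.

(** The functions [wt], [wx], [wtx] are the elementwise derivatives of
    [w].  The [t]-derivative exists for every [x], nodes included, since the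
    spatial factors are only frozen; the others exist inside the cells. *)
Definition fe_jet w wt wx wtx :=
  [/\ cw wx, cw wtx,
      forall t x, t \in `]a, b[ -> is_derive t 1 (w ^~ x) (wt t x) &
      forall m t x, (m < M)%N -> t \in `]a, b[ -> space_elt x_ m x ->
        [/\ is_derive x 1 (w t) (wx t x), is_derive x 1 (wt t) (wtx t x) &
            is_derive t 1 (wx ^~ x) (wtx t x)]].

(** Differentiate the factors: in time the degree drops by one and the
    spatial factors stay continuous and periodic, so [wt] is again a tensor. *)
Lemma fe_tensor_jet r w : fe_tensor r.+1 w ->
  exists wt wx wtx, fe_tensor r wt /\ fe_jet w wt wx wtx.
Proof.
move=> [k [A [B [HAB HE]]]].
exists (fun t x => \sum_(j < k) (A j)^`().[t] * B j x),
  (fun t x => \sum_(j < k) (A j).[t] * derive1 (B j) x),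
  (fun t x => \sum_(j < k) (A j)^`().[t] * derive1 (B j) x).
have cwx (P : 'I_k -> {poly R}) :
    cw (fun t x => \sum_(j < k) (P j).[t] * derive1 (B j) x).
  apply: cellwise_sum => j; apply: cellwiseM.
    by apply: cellwise_time; exact: continuous_horner.
  by apply: cellwise_space; apply: space_C_derive1; exact: (HAB j).2.
have dx_ (P : 'I_k -> {poly R}) m t x : (m < M)%N -> space_elt x_ m x ->
    is_derive x 1 (fun y => \sum_(j < k) (P j).[t] * B j y)
      (\sum_(j < k) (P j).[t] * derive1 (B j) x).
  move=> mM xm; apply: is_derive_sumE => j; apply: is_derive_scale.
  by apply: (space_C_is_derive _ mM xm); exact: (HAB j).2.
have dt_ (t : R) (c : 'I_k -> R) : is_derive t 1 (fun s => \sum_(j < k) (A j).[s] * c j)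
      (\sum_(j < k) (A j)^`().[t] * c j).
  apply: is_derive_sumE => j.
  have := is_derive_mul (is_derive_poly (A j) t) (is_derive_cst (c j) t 1).
  by rewrite mulr0 addr0.
split.
  exists k, (fun j => (A j)^`()), B; split=> // j; split; last exact: (HAB j).2.
  have [->|An0] := eqVneq (A j) 0; first by rewrite deriv0 size_poly0.
  by rewrite -ltnS (leq_trans (lt_size_deriv An0))// (HAB j).1.
split; [exact: cwx|exact: cwx| |].
  move=> t x tab; apply: (is_derive_eq_itv tab) (dt_ _ _) => s /subset_itv_oo_co sab.
  exact: HE.
move=> m t x mM tab xm; split; [|exact: (dx_ _ m)|exact: dt_].
rewrite (_ : w t = fun x => \sum_(j < k) (A j).[t] * B j x); last first.
  by apply/funext => y; rewrite HE//; exact: subset_itv_oo_co.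
exact: (dx_ _ m).
Qed.

End FETensor.

(** * Orthogonal projection onto a space determined by finitely many functionals *)

Section AbstractProjection.
Context {R : realFieldType} {E : lmodType R}.
Variables (W : set E) (ip : E -> E -> R).
Hypothesis W_lin : forall c u v, W u -> W v -> W (u + c *: v).
Hypothesis ipC : forall u v, ip u v = ip v u.
Hypothesis ip_linl : forall c u v w, W u -> W v -> W w ->
  ip (u + c *: v) w = ip u w + c * ip v w.
Hypothesis ip_ge0 : forall u, 0 <= ip u u.

Lemma ip_linr c u v w : W u -> W v -> W w ->
  ip w (u + c *: v) = ip w u + c * ip w v.
Proof. by move=> Wu Wv Ww; rewrite ipC ip_linl// !(ipC w). Qed.

(** Cauchy-Schwarz in the degenerate case: otherwise
    [ip (f + s e) (f + s e)] would be an affine function of [s] with nonzero slope,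
    hence negative somewhere. *)
Lemma ip_null f e : W f -> W e -> ip e e = 0 -> ip f e = 0.
Proof.
move=> Wf We e0; apply/eqP/negPn/negP => fe0.
(* With this coefficient the quadratic form takes the value [-1]. *)
have := ip_ge0 (f + (- (ip f f + 1) / (2 * ip f e)) *: e).
rewrite ip_linl//; last exact: W_lin.
rewrite !ip_linr// e0 mulr0 addr0 (ipC e f).
have -> : - (ip f f + 1) / (2 * ip f e) * ip f e = - (ip f f + 1) / 2.
  by field.
by lra.
Qed.

(** No basis of [V] is available, only linear functionals that separate
    its points up to null vectors.  By induction on their number: the kernel
    of the last functional in [V] has projections, and if it is not all of [V],
    one vector [e] orthogonal to that kernel spans the rest. *)
Lemma exists_projection (phi : nat -> E -> R) d (V : set E) :
  (forall k c u v, phi k (u + c *: v) = phi k u + c * phi k v) ->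
  V `<=` W -> V 0 -> (forall c u v, V u -> V v -> V (u + c *: v)) ->
  (forall v, V v -> (forall k, (k < d)%N -> phi k v = 0) ->
    forall w, W w -> ip w v = 0) ->
  forall f, W f -> exists g, V g /\ forall v, V v -> ip g v = ip f v.
Proof.
move=> phi_lin; elim: d V => [|d IH] V VW V0 V_lin Vnull f Wf.
  by exists 0; split=> // v Vv; rewrite !(Vnull v)//; exact: VW.
have W0 : W 0 by exact: VW.
pose K : set E := [set v | V v /\ phi d v = 0].
have phi0 : phi d 0 = 0.
  by have := phi_lin d (-1) 0 0; rewrite scaler0 addr0 mulN1r subrr.
have projK h : W h -> exists g, K g /\ forall v, K v -> ip g v = ip h v.
  apply: IH.
  - by move=> v [/VW].
  - by [].
  - move=> c u v [Vu u0] [Vv v0]; split; first exact: V_lin.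
    by rewrite phi_lin u0 v0 mulr0 addr0.
  - move=> v [Vv v0] kv; apply: Vnull => // k; rewrite ltnS leq_eqVlt.
    by move=> /predU1P[->|/kv].
have [[u [Vu u0]]|noV] := pselect (exists u, V u /\ phi d u != 0); last first.
  have [g [[Vg _] gP]] := projK f Wf; exists g; split=> // v Vv; apply: gP.
  by split=> //; apply/eqP/negPn/negP => v0; apply: noV; exists v.
have [Pu [[VPu Pu0] PuP]] := projK u (VW _ Vu).
pose e := u + (-1) *: Pu.
have Ve : V e by exact: V_lin.
have e0 : phi d e != 0 by rewrite phi_lin Pu0 mulr0 addr0.
have eK v : K v -> ip e v = 0.
  move=> Kv; rewrite ip_linl ?PuP ?mulN1r ?subrr//; try exact: VW.
  by case: Kv => /VW.
have [g [[Vg g0] gP]] := projK f Wf.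
(* If [ip e e = 0], the quotient is [0], and it does not matter because [e] is
   then orthogonal to everything. *)
exists (g + (ip f e / ip e e) *: e); split; first exact: V_lin.
move=> v Vv; pose c := phi d v / phi d e; pose v0 := v + (- c) *: e.
have Kv0 : K v0.
  split; first exact: V_lin.
  by rewrite phi_lin /c mulNr divfK// subrr.
have vE : v = v0 + c *: e by rewrite /v0 scaleNr subrK.
have Wv0 : W v0 by case: Kv0 => /VW.
have We : W e by exact: VW.
have Wg : W g by exact: VW.
clearbody v0 e c; rewrite vE (ip_linr c Wv0 We Wf) ip_linr//; last exact: W_lin.
rewrite !ip_linl// (gP _ Kv0) (eK _ Kv0) (ipC g e) (eK g)//.
rewrite mulr0 addr0 add0r; congr (_ + c * _).
have [ee0|ee0] := eqVneq (ip e e) 0; last by rewrite divfK.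
by rewrite ee0 mulr0 (ip_null Wf We ee0).
Qed.

Lemma exists_projection_fin (F : finType) (phi : F -> E -> R) (V : set E) :
  (forall k c u v, phi k (u + c *: v) = phi k u + c * phi k v) ->
  V `<=` W -> V 0 -> (forall c u v, V u -> V v -> V (u + c *: v)) ->
  (forall v, V v -> (forall k, phi k v = 0) -> forall w, W w -> ip w v = 0) ->
  forall f, W f -> exists g, V g /\ forall v, V v -> ip g v = ip f v.
Proof.
move=> phi_lin VW V0 V_lin Vnull.
apply: (@exists_projection
  (fun n v => oapp (fun j : 'I_#|F| => phi (enum_val j) v) 0 (insub n)) #|F|) => //.
  move=> n c u v; case: insub => [j|] /=; first exact: phi_lin.
  by rewrite mulr0 addr0.
move=> v Vv v0; apply: Vnull => // k.
by have := v0 (enum_rank k) (ltn_ord _); rewrite valK /= enum_rankK.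
Qed.

End AbstractProjection.

(** * The space-time projection *)

Section Unisolvence.
Context {R : realType}.

(** Equispaced interior points, as many as a polynomial of degree [r] has
    coefficients. *)
Definition sample (a b : R) (r k : nat) : R := a + (b - a) * (k.+1%:R / r.+2%:R).

Lemma sample_in a b r k : a < b -> (k < r.+1)%N -> sample a b r k \in `]a, b[.
Proof.
move=> ab kr; have ba : 0 < b - a by rewrite subr_gt0.
rewrite in_itv /=; apply/andP; split.
  by rewrite ltrDl mulr_gt0// divr_gt0 ?ltr0n.
rewrite -ltrBrDl gtr_pMr// ltr_pdivrMr ?ltr0n//.
by rewrite mul1r ltr_nat.
Qed.

Lemma poly_sample_eq0 a b r (P : {poly R}) : a < b -> (size P <= r.+1)%N ->
  (forall k, (k < r.+1)%N -> P.[sample a b r k] = 0) -> P = 0.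
Proof.
move=> ab sP P0; apply/eqP/negPn/negP => Pn0.
have inj : injective (sample a b r).
  move=> k l /addrI /mulfI; rewrite subr_eq0 gt_eqF// => /(_ isT).
  move=> /(congr1 (fun z => z * r.+2%:R)); rewrite !divfK ?pnatr_eq0//.
  by move=> /eqP; rewrite eqr_nat eqSS => /eqP.
have := @max_poly_roots _ P [seq sample a b r k | k <- iota 0 r.+1] Pn0.
rewrite map_inj_uniq ?iota_uniq// size_map size_iota => /(_ _ isT).
rewrite ltnNge sP => /(_ _)/notF; apply.
apply/allP => _ /mapP[k + ->]; rewrite mem_iota add0n => /andP[_ kr].
exact/rootP/P0.
Qed.

End Unisolvence.

Section FEProjection.
Context {R : realType} {D : nat} (a b : R) (M : nat) (x_ : nat -> R) (q p : nat).
Hypothesis ab : a < b.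
Hypothesis hx : is_mesh 0 1 M x_.
Implicit Types u v w : R -> R -> 'cV[R]_D.
Notation cw := (cellwise_continuous a b M x_).
Notation J := (spacetime_integral `[a, b[%classic).
Notation V := (@tensor_space R D `[a, b[%classic
  (poly_on `[a, b[%classic q) (space_C M x_ p)).

Definition col_cellwise u := forall i, cw (fun t x => u t x i 0).

Definition spacetime_ip u v : R := J (fun t x => dot (u t x) (v t x)).

Lemma cellwise_dot u v : col_cellwise u -> col_cellwise v ->
  cw (fun t x => dot (u t x) (v t x)).
Proof. by move=> cu cv; apply: cellwise_sum => i; exact: cellwiseM. Qed.

Lemma cellwiseZ c (f : R -> R -> R) : cw f -> cw (fun t x => c * f t x).
Proof. by move=> cf; exact: (cellwiseM (@cellwise_cst R a b M x_ c) cf). Qed.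

Lemma col_cellwise_mulmx (A : 'M[R]_D) u : col_cellwise u ->
  col_cellwise (fun t x => A *m u t x).
Proof.
move=> cu i; apply: (@cellwise_eq _ _ _ _ _ _
  (fun t x => \sum_j A i j * u t x j 0)) => [*|]; first by rewrite mxE.
by apply: cellwise_sum => j; exact: cellwiseZ.
Qed.

Lemma col_cellwise_lin c u v : col_cellwise u -> col_cellwise v ->
  col_cellwise (u + c *: v).
Proof.
move=> cu cv i; apply: (@cellwise_eq _ _ _ _ _ _
  (fun t x => u t x i 0 + c * v t x i 0)) => [m t x *|]; first by rewrite !fctE !mxE.
by apply: cellwiseD => //; exact: cellwiseZ.
Qed.

Lemma tensor_col_cellwise v : V v -> col_cellwise v.
Proof. by move=> /tensor_spaceP Vv i; exact: fe_tensor_cellwise (Vv i). Qed.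

Lemma tensor_lin c u v : V u -> V v -> V (u + c *: v).
Proof.
move=> /tensor_spaceP Vu /tensor_spaceP Vv; apply/tensor_spaceP => i.
apply: fe_tensor_eq (fe_tensorD (Vu i) (fe_tensorZ c (Vv i))) => t x _.
by rewrite !fctE !mxE.
Qed.

Lemma tensor_mulmx (A : 'M[R]_D) v : V v -> V (fun t x => A *m v t x).
Proof.
move=> /tensor_spaceP Vv; apply/tensor_spaceP => i.
apply: (@fe_tensor_eq _ _ _ _ _ _ _ _ (fun t x => \sum_j A i j * v t x j 0)) => [*|].
  by rewrite mxE.
by apply: fe_tensor_sum => j; exact: fe_tensorZ.
Qed.

(** Unisolvence of the tensor grid: at a fixed spatial sample point the
    function is a polynomial of degree [q] in [t] with [q + 1] zeros, so it
    vanishes for all [t]; then at fixed [t] the same argument applies in [x]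
    on every element. *)
Lemma tensor_sample_eq0 v : V v ->
  (forall (i : 'I_D) (k : 'I_q.+1) (m : 'I_M) (l : 'I_p.+1),
    v (sample a b q k) (sample (x_ m) (x_ m.+1) p l) i 0 = 0) ->
  forall m t x, (m < M)%N -> t \in `]a, b[ -> space_elt x_ m x -> v t x = 0.
Proof.
move=> /tensor_spaceP Vv v0 m t x mM tab xm; apply/colP => i; rewrite mxE.
have [k [A [B [HAB HE]]]] := Vv i.
have [_ _ lx] := hx.
have vt y : (exists2 l : 'I_p.+1, True & y = sample (x_ m) (x_ m.+1) p l) ->
    v t y i 0 = 0.
  move=> [l _ ->]; set y0 := sample _ _ _ _.
  rewrite HE; last exact: subset_itv_oo_co.
  have -> : \sum_(j < k) (A j).[t] * B j y0 =
      (\sum_(j < k) B j y0 *: A j).[t].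
    by rewrite horner_sum; apply: eq_bigr => j _; rewrite hornerZ mulrC.
  rewrite (@poly_sample_eq0 _ a b q (\sum_(j < k) B j y0 *: A j)) ?horner0//.
    apply: (leq_trans (size_sum _ _ _)); apply/bigmax_leqP => j _.
    exact: leq_trans (size_scale_leq _ _) (HAB j).1.
  move=> n nq; have := v0 i (Ordinal nq) (Ordinal mM) l.
  rewrite HE /=; last exact/subset_itv_oo_co/sample_in.
  move=> E0; rewrite -[RHS]E0 horner_sum; apply: eq_bigr => j _.
  by rewrite hornerZ mulrC.
have /choice [P HP] : forall j, exists P : {poly R}, (size P <= p.+1)%N /\
    forall s, space_elt x_ m s -> B j s = P.[s].
  by move=> j; have [[/(_ m mM)[P sP BP] _] _] := (HAB j).2; exists P.
have vE y : space_elt x_ m y -> v t y i 0 = (\sum_(j < k) (A j).[t] *: P j).[y].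
  move=> ym; rewrite HE; last exact: subset_itv_oo_co.
  rewrite horner_sum; apply: eq_bigr => j _; rewrite hornerZ; congr (_ * _).
  exact: (HP j).2.
rewrite vE// (@poly_sample_eq0 _ (x_ m) (x_ m.+1) p (\sum_(j < k) (A j).[t] *: P j)).
- by rewrite horner0.
- exact: lx.
- apply: (leq_trans (size_sum _ _ _)); apply/bigmax_leqP => j _.
  exact: leq_trans (size_scale_leq _ _) (HP j).1.
- move=> l lp; rewrite -vE; last by apply: sample_in => //; exact: lx.
  by apply: vt; exists (Ordinal lp).
Qed.

Lemma spacetime_ipC u v : spacetime_ip u v = spacetime_ip v u.
Proof.
rewrite /spacetime_ip; congr spacetime_integral; apply/funext => t; apply/funext => x.
exact: dotC.
Qed.

Lemma spacetime_ip_lin c u v w : col_cellwise u -> col_cellwise v -> col_cellwise w ->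
  spacetime_ip (u + c *: v) w = spacetime_ip u w + c * spacetime_ip v w.
Proof.
move=> cu cv cw_; rewrite /spacetime_ip -(spacetime_integralZ hx); last exact: cellwise_dot.
rewrite -(spacetime_integralD hx); first last.
- by apply: cellwiseZ; exact: cellwise_dot.
- exact: cellwise_dot.
congr spacetime_integral; apply/funext => t; apply/funext => x.
by rewrite !fctE dotDl dotZl.
Qed.

Lemma spacetime_ip_ge0 u : 0 <= spacetime_ip u u.
Proof.
by apply: spacetime_integral_ge0 => t x; apply: sumr_ge0 => i _; exact: sqr_ge0.
Qed.

(** The choice operator in the definition of the projection returns a
    meaningful value because a projection exists. *)
Lemma L2proj_spacetimeP f : col_cellwise f ->
  V (L2proj_spacetime `[a, b[%classic V f) /\
  forall v, V v -> spacetime_ip (L2proj_spacetime `[a, b[%classic V f) v = spacetime_ip f v.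
Proof.
move=> cf.
suff H : exists g, V g /\ forall v, V v -> spacetime_ip g v = spacetime_ip f v by exact: (getPex H).
have [] := @exists_projection_fin R (R -> R -> 'cV[R]_D) col_cellwise spacetime_ip _ _ _ _
  ('I_D * 'I_q.+1 * 'I_M * 'I_p.+1)%type
  (fun z v => v (sample a b q z.1.1.2) (sample (x_ z.1.2) (x_ z.1.2.+1) p z.2)
     z.1.1.1 0) V _ _ _ _ _ f cf.
- by move=> *; exact: col_cellwise_lin.
- exact: spacetime_ipC.
- exact: spacetime_ip_lin.
- exact: spacetime_ip_ge0.
- by move=> k c u v; rewrite !fctE !mxE.
- exact: tensor_col_cellwise.
- apply/tensor_spaceP => i; apply: fe_tensor_eq (fe_tensor0 _ _ _ _ _ _) => t x _.
  by rewrite mxE.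
- by move=> *; exact: tensor_lin.
- move=> v Vv v0 w cw_; rewrite /spacetime_ip.
  rewrite (@spacetime_integral_eq _ _ _ _ _ hx _ (fun _ _ => 0)).
  + exact: (spacetime_integral0 _ _ hx).
  + exact: cellwise_cst.
  + move=> m t x mM tab xm.
    rewrite (@tensor_sample_eq0 v Vv _ m t x)// => [|i k m' l]; last first.
      exact: (v0 (i, k, m', l)).
    exact: dot0r.
- by move=> g gP; exists g.
Qed.

End FEProjection.

(** * Conservation laws on one time element *)

Section CellwiseComposition.
Context {R : realType} {D : nat} (a b : R) (M : nat) (x_ : nat -> R).

(** Needed for the nonlinear term, with [h] a partial derivative of
    [S]. *)
Lemma cellwise_comp (h : 'cV[R]_D -> R) (u : R -> R -> 'cV[R]_D) :
  continuous h -> col_cellwise a b M x_ u ->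
  cellwise_continuous a b M x_ (fun t x => h (u t x)).
Proof.
move=> ch cu m mM.
have /choice [g gP] : forall i, exists g : R * R -> R, continuous g /\
    forall t x, t \in `]a, b[ -> space_elt x_ m x -> u t x i 0 = g (t, x).
  by move=> i; have [g] := cu i m mM; exists g.
exists (fun z => h (\col_i g i z)).
  have cg : continuous (fun z => \sum_i g i z *: (delta_mx i 0 : 'cV[R]_D)).
    apply: continuous_big => [|i _]; first exact: add_continuous.
    by move=> z; apply: cvgZ; [exact: (gP i).1|exact: cvg_cst].
  move=> z; apply: (@continuous_comp _ _ _ (fun z => \col_i g i z) h); last exact: ch.
  rewrite (_ : (fun z => _) = (fun z => \sum_i g i z *: (delta_mx i 0 : 'cV[R]_D))).
    exact: cg.
  apply/funext => y; rewrite [LHS]matrix_sum_delta; apply: eq_bigr => i _.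
  by rewrite big_ord1 mxE.
move=> t x tab xm; congr h; apply/colP => i; rewrite mxE; exact: (gP i).2.
Qed.

End CellwiseComposition.

Section ColumnJets.
Context {R : realType} {D : nat} (a b : R) (M : nat) (x_ : nat -> R) (q p : nat).
Notation V := (@tensor_space R D `[a, b[%classic
  (poly_on `[a, b[%classic q) (space_C M x_ p)).

(** Vector-valued analogue of [fe_jet]. *)
Definition col_jet (Z Zt Zx Ztx : R -> R -> 'cV[R]_D) :=
  [/\ col_cellwise a b M x_ Zx, col_cellwise a b M x_ Ztx,
      forall t x, t \in `]a, b[ -> col_derive t (Z ^~ x) (Zt t x) &
      forall m t x, (m < M)%N -> t \in `]a, b[ -> space_elt x_ m x ->
        [/\ col_derive x (Z t) (Zx t x), col_derive x (Zt t) (Ztx t x) &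
            col_derive t (Zx ^~ x) (Ztx t x)]].

Lemma exists_col_jet (Z : R -> R -> 'cV[R]_D) :
  (forall i, fe_tensor a b M x_ p q.+1 (fun t x => Z t x i 0)) ->
  exists Zt Zx Ztx, V Zt /\ col_jet Z Zt Zx Ztx.
Proof.
move=> ZP.
have /choice [jet jetP] : forall i,
    exists w : (R -> R -> R) * (R -> R -> R) * (R -> R -> R),
    fe_tensor a b M x_ p q w.1.1 /\
    fe_jet a b M x_ (fun t x => Z t x i 0) w.1.1 w.1.2 w.2.
  move=> i; have [wt [wx [wtx H]]] := fe_tensor_jet (ZP i).
  by exists (wt, wx, wtx).
pose Y (w : 'I_D -> R -> R -> R) t x : 'cV[R]_D := \col_i w i t x.
have YE w i : (fun t x => Y w t x i 0) = w i.
  by apply/funext => t; apply/funext => x; rewrite mxE.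
have Yx w t i : (fun y => Y w t y i 0) = w i t.
  by apply/funext => y; rewrite mxE.
have Yt w x i : (fun s => Y w s x i 0) = (w i)^~ x.
  by apply/funext => s; rewrite mxE.
exists (Y (fun i => (jet i).1.1)), (Y (fun i => (jet i).1.2)),
  (Y (fun i => (jet i).2)); split.
  by apply/tensor_spaceP => i; rewrite YE; exact: (jetP i).1.
split=> [i|i|t x tab i|m t x mM tab xm].
- by rewrite YE; have [_ []] := jetP i.
- by rewrite YE; have [_ []] := jetP i.
- by rewrite mxE; have [_ [_ _ + _]] := jetP i; apply.
- by split=> i; have [_ [_ _ _ /(_ m t x mM tab xm) [? ? ?]]] := jetP i;
    rewrite ?Yx ?Yt mxE.
Qed.

End ColumnJets.

Section ConservationLaws.
Context {R : realType} {D : nat} (a b : R) (M : nat) (x_ : nat -> R) (q p : nat).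
Hypothesis hx : is_mesh 0 1 M x_.
Notation V := (@tensor_space R D `[a, b[%classic
  (poly_on `[a, b[%classic q) (space_C M x_ p)).
Notation cw := (cellwise_continuous a b M x_).
Notation J := (spacetime_integral `[a, b[%classic).
Notation ip := (spacetime_ip a b).
Variables (Z Zt Zx Ztx : R -> R -> 'cV[R]_D).
Hypothesis ZP : forall i, fe_tensor a b M x_ p q.+1 (fun t x => Z t x i 0).
Hypothesis VZt : V Zt.
Hypothesis jetZ : col_jet a b M x_ Z Zt Zx Ztx.
Variables (K L : 'M[R]_D) (S : 'cV[R]_D -> R).
Hypothesis hS : continuously_differentiable S.
Hypothesis hK : skew_symmetric K.
Hypothesis hL : skew_symmetric L.

Let cZ : col_cellwise a b M x_ Z.
Proof. by move=> i; exact: fe_tensor_cellwise (ZP i). Qed.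

Let cZt : col_cellwise a b M x_ Zt.
Proof. exact: tensor_col_cellwise VZt. Qed.

Let cZx : col_cellwise a b M x_ Zx. Proof. by case: jetZ. Qed.
Let cZtx : col_cellwise a b M x_ Ztx. Proof. by case: jetZ. Qed.

Let cgrad : col_cellwise a b M x_ (fun t x => grad S (Z t x)).
Proof.
move=> i; apply: (cellwise_comp (h := fun z => grad S z i 0)) => //.
move=> z; apply: (@continuous_comp _ _ _ (grad S) (fun A => A i 0)).
  exact: hS.2.
exact: coord_continuous.
Qed.

Let cmul (A : 'M[R]_D) u : col_cellwise a b M x_ u ->
  col_cellwise a b M x_ (fun t x => A *m u t x).
Proof. exact: col_cellwise_mulmx. Qed.

Lemma dt_jet t x : t \in `]a, b[ -> dt Z t x = Zt t x.
Proof.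
by move=> tab; apply/derive1_is_derive/col_derive1; case: jetZ => _ _ + _; apply.
Qed.

Lemma dx_jet m t x : (m < M)%N -> t \in `]a, b[ -> space_elt x_ m x ->
  dx Z t x = Zx t x.
Proof.
move=> mM tab xm; apply/derive1_is_derive/col_derive1.
by case: jetZ => _ _ _ /(_ m t x mM tab xm) [].
Qed.

(** The density contains [dx Z], which agrees with [Zx] only inside
    the elements; at a fixed such [x] this suffices to differentiate in [t]. *)
Lemma dt_density A m t x : (m < M)%N -> t \in `]a, b[ -> space_elt x_ m x ->
  is_derive t 1 (fun s => 2^-1 * dot (dx Z s x) (A *m Z s x))
    (2^-1 * (dot (Ztx t x) (A *m Z t x) + dot (Zx t x) (A *m Zt t x))).
Proof.
move=> mM tab xm; apply: is_derive_scale.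
apply: (@is_derive_eq_itv _ _ _ (fun s => dot (Zx s x) (A *m Z s x)) a b) => //.
  by move=> s sab; rewrite (dx_jet mM).
have [_ _ /(_ t x tab) Dt /(_ m t x mM tab xm) [_ _ Dtx]] := jetZ.
exact: (col_derive_dot Dtx (col_derive_mulmx A Dt)).
Qed.

(** Here [dt Z] agrees with [Zt] at all [x], so the flux may be
    replaced by an explicit function before differentiating. *)
Lemma dx_flux A m t x : (m < M)%N -> t \in `]a, b[ -> space_elt x_ m x ->
  is_derive x 1 (fun y => 2^-1 * dot (dt Z t y) (A *m Z t y))
    (2^-1 * (dot (Ztx t x) (A *m Z t x) + dot (Zt t x) (A *m Zx t x))).
Proof.
move=> mM tab xm; apply: is_derive_scale.
rewrite (_ : (fun y => _) = fun y => dot (Zt t y) (A *m Z t y)); last first.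
  by apply/funext => y; rewrite dt_jet.
have [_ _ _ /(_ m t x mM tab xm) [Dx Dtx _]] := jetZ.
exact: (col_derive_dot Dtx (col_derive_mulmx A Dx)).
Qed.

Let cdx A : cw (fun t x =>
  dot (Ztx t x) (A *m Z t x) + dot (Zt t x) (A *m Zx t x)).
Proof. by apply: cellwiseD; apply: cellwise_dot => //; exact: cmul. Qed.

(** The integrand is the [x]-derivative of [Zt . A Z], a continuous
    periodic function of [x]. *)
Lemma spacetime_integral_dx_eq0 A :
  J (fun t x => dot (Ztx t x) (A *m Z t x) + dot (Zt t x) (A *m Zx t x)) = 0.
Proof.
rewrite -[RHS](spacetime_integral0 a b hx).
apply: (spacetime_integral_eq_slice hx) => [|t tab]; first exact: cellwise_cst.
rewrite (space_integral0 hx).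
apply: (@space_integral_derive _ M x_ hx (fun y => dot (Zt t y) (A *m Z t y))).
- apply: continuous_dot => i.
    move/tensor_spaceP : VZt => /(_ i); apply: fe_tensor_continuous; exact: subset_itv_oo_co.
  rewrite (_ : (fun z => _) = (fun z => \sum_j A i j * Z t z j 0)).
    apply: continuous_big => [|j _]; first exact: add_continuous.
    move=> z; apply: cvgM; first exact: cvg_cst.
    exact: (fe_tensor_continuous (subset_itv_oo_co tab) (ZP j)).
  by apply/funext => z; rewrite mxE.
- have Zp : Z t 1 = Z t 0.
    apply/colP => i; rewrite -[in LHS](add0r 1).
    exact: (fe_tensor_periodic _ (subset_itv_oo_co tab) (ZP i)).
  have Ztp : Zt t 1 = Zt t 0.
    apply/colP => i; rewrite -[in LHS](add0r 1).
    by move/tensor_spaceP : VZt => /(_ i) /(fe_tensor_periodic 0 (subset_itv_oo_co tab)).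
  by rewrite Zp Ztp.
- exact: cellwise_slice tab (cdx A).
- move=> m x mM xm; have [_ _ _ /(_ m t x mM tab xm) [Dx Dtx _]] := jetZ.
  exact: (col_derive_dot Dtx (col_derive_mulmx A Dx)).
Qed.

Lemma cellwise_fem_residual phi : V phi -> cw (fun t x =>
  dot (K *m Zt t x) (phi t x) + dot (L *m Zx t x) (phi t x)
  - dot (grad S (Z t x)) (phi t x)).
Proof.
move=> /tensor_col_cellwise cphi.
apply: (@cellwise_eq _ _ _ _ _ _ (fun t x =>
  dot (K *m Zt t x) (phi t x) + dot (L *m Zx t x) (phi t x)
  + (-1) * dot (grad S (Z t x)) (phi t x))) => [*|]; first by rewrite mulN1r.
apply: cellwiseD; last by apply: cellwiseZ; exact: cellwise_dot.
by apply: cellwiseD; apply: cellwise_dot => //; exact: cmul.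
Qed.

Hypothesis fem : forall phi, V phi -> J (fun t x =>
  dot (K *m Zt t x) (phi t x) + dot (L *m Zx t x) (phi t x)
  - dot (grad S (Z t x)) (phi t x)) = 0.

Lemma energy_law : J (fun t x =>
  dt (energy_density L S Z) t x + dx (energy_flux L Z) t x) = 0.
Proof.
(* [E] is the residual of the method tested with [Zt]. *)
pose E t x := dot (K *m Zt t x) (Zt t x) + dot (L *m Zx t x) (Zt t x)
  - dot (grad S (Z t x)) (Zt t x).
transitivity (J (fun t x =>
  (dot (Ztx t x) (L *m Z t x) + dot (Zt t x) (L *m Zx t x)) + (-1) * E t x)).
  apply: (spacetime_integral_eq hx).
    by apply: cellwiseD => //; apply: cellwiseZ; exact: cellwise_fem_residual.
  move=> m t x mM tab xm.
  rewrite /dx (derive1_is_derive (dx_flux L mM tab xm)).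
  have dS : is_derive t 1 (fun s => S (Z s x)) (dot (grad S (Z t x)) (Zt t x)).
    apply: is_derive_grad; first exact: hS.1.
    by case: jetZ => _ _ + _; apply.
  rewrite /dt (derive1_is_derive (is_deriveD (dt_density L mM tab xm) dS)).
  rewrite /E (dotC (K *m _)) (dotC (L *m _)) (dot_mulmx_self _ hK).
  by rewrite (dot_mulmx_skew (Zx t x) _ hL); field.
rewrite (spacetime_integralD hx)//; last by apply: cellwiseZ; exact: cellwise_fem_residual.
rewrite spacetime_integral_dx_eq0 (spacetime_integralZ hx) ?fem ?mulr0 ?addr0//.
exact: cellwise_fem_residual.
Qed.

Lemma momentum_law P : V P -> (forall v, V v -> ip P v = ip Zx v) ->
  J (fun t x => dt (momentum_density K Z) t x
    + dx (fun s y => momentum_flux K S Z s y + S (Z s y)) t x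
    - dot (grad S (Z t x)) (P t x)) = 0.
Proof.
move=> VP PP; have cP := tensor_col_cellwise VP.
pose E t x := dot (K *m Zt t x) (P t x) + dot (L *m Zx t x) (P t x)
  - dot (grad S (Z t x)) (P t x).
(* The integrand splits into an exact [x]-derivative, the residual [E] tested
   with [P], and two terms [F], [G] that integrate to [0]: [Zx - P] is orthogonal to
   [K Zt] and to [L P], and [P . L P = 0]. *)
pose F t x := dot (Zx t x) (K *m Zt t x) + (-1) * dot (P t x) (K *m Zt t x).
pose G t x := dot (Zx t x) (L *m P t x).
have cE : cw E := cellwise_fem_residual VP.
have cF : cw F.
  apply: cellwiseD; last apply: cellwiseZ; apply: cellwise_dot => //; exact: cmul.
have cG : cw G by apply: cellwise_dot => //; exact: cmul.
transitivity (J (fun t x =>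
  (dot (Ztx t x) (K *m Z t x) + dot (Zt t x) (K *m Zx t x)) + E t x
  + F t x + G t x)).
  apply: (spacetime_integral_eq hx).
    exact: cellwiseD (cellwiseD (cellwiseD (cdx K) cE) cF) cG.
  move=> m t x mM tab xm.
  rewrite /dt (derive1_is_derive (dt_density K mM tab xm)).
  rewrite /dx (_ : (fun y => _) = fun y => 2^-1 * dot (dt Z t y) (K *m Z t y)).
    rewrite (derive1_is_derive (dx_flux K mM tab xm)).
    rewrite /E /F /G (dotC (K *m _)) (dotC (L *m _)).
    rewrite (dot_mulmx_skew (Zx t x) (Zt t x) hK).
    by rewrite (dot_mulmx_skew (P t x) _ hL); field.
  by apply/funext => y; rewrite /momentum_flux subrK.
rewrite (spacetime_integralD hx (cellwiseD (cellwiseD (cdx K) cE) cF) cG).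
rewrite (spacetime_integralD hx (cellwiseD (cdx K) cE) cF).
rewrite (spacetime_integralD hx (cdx K) cE).
rewrite spacetime_integral_dx_eq0 fem// !add0r.
have VK : V (fun t x => K *m Zt t x) by exact: tensor_mulmx.
have VL : V (fun t x => L *m P t x) by exact: tensor_mulmx.
have -> : J F = 0.
  rewrite (spacetime_integralD hx); [|by apply: cellwise_dot => //; exact: cmul|].
    rewrite (spacetime_integralZ hx); last by apply: cellwise_dot => //; exact: cmul.
    by rewrite -![J _]/(ip _ (fun t x => K *m Zt t x)) PP// mulN1r subrr.
  by apply: cellwiseZ; apply: cellwise_dot => //; exact: cmul.
rewrite add0r -[J _]/(ip _ (fun t x => L *m P t x)) -PP// /ip.
have -> : (fun t x => dot (P t x) (L *m P t x)) = (fun _ _ => 0).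
  by apply/funext => t; apply/funext => x; exact: dot_mulmx_self.
exact: (spacetime_integral0 _ _ hx).
Qed.

End ConservationLaws.

(** * Restriction to one time element *)

Section Localization.
Context {R : realType} {D : nat} (T : R) (N : nat) (t_ : nat -> R).
Context (M : nat) (x_ : nat -> R) (q p n : nat).
Hypothesis ht : is_mesh 0 T N t_.
Hypothesis hn : (n < N)%N.
Notation I := `[t_ n, t_ n.+1[%classic.

Lemma time_elt_subset : I `<=` `[0, T]%classic.
Proof.
have [t0 tN _] := ht; move=> t; rewrite /= !in_itv /= => /andP[nt tn].
rewrite -t0 -tN (le_trans _ nt) ?(mesh_le ht) ?leq0n ?(ltnW hn)//=.
by rewrite (le_trans (ltW tn))// (mesh_le ht)// hn leqnn.
Qed.

Lemma time_elt_disjoint m t : (m < N)%N -> m <> n -> time_elt t_ m t -> ~ I t.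
Proof.
move=> mN mn; rewrite /time_elt /= !in_itv /= => /andP[mt tm] /andP[nt tn].
have [mn'|nm|//] := ltngtP m n.
  have := mesh_le (i := m.+1) (j := n) ht.
  by rewrite mn' ltnW// => /(_ isT); apply/negP; rewrite -ltNge (le_lt_trans nt).
have := mesh_le (i := n.+1) (j := m) ht.
by rewrite nm ltnW// => /(_ isT); apply/negP; rewrite -ltNge (le_lt_trans mt).
Qed.

Lemma tensor_C_fe_tensor r (Z : R -> R -> 'cV[R]_D) i :
  tensor_space `[0, T]%classic (time_C T N t_ r) (space_C M x_ p) Z ->
  fe_tensor (t_ n) (t_ n.+1) M x_ p r (fun t x => Z t x i 0).
Proof.
move=> /(_ i) [k [A [B [HAB HE]]]].
have /choice [P HP] : forall j, exists P : {poly R}, (size P <= r.+1)%N /\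
    forall s, I s -> A j s = P.[s].
  by move=> j; have [[/(_ n hn)[P sP AP] _] _] := HAB j; exists P.
exists k, P, B; split=> [j|t x tI].
  by split; [exact: (HP j).1|exact: (HAB j).2].
rewrite HE; last exact: time_elt_subset.
by apply: eq_bigr => j _; rewrite (HP j).2.
Qed.

(** The temporal test space is discontinuous, so cutting off outside one
    element stays inside it. *)
Lemma extend_by_zero_tensor (phi : R -> R -> 'cV[R]_D) :
  tensor_space I (poly_on I q) (space_C M x_ p) phi ->
  tensor_space `[0, T]%classic (time_D N t_ q) (space_C M x_ p)
    (fun t x => if t \in I then phi t x else 0).
Proof.
move=> Vphi i; have [k [A [B [HAB HE]]]] := Vphi i.
exists k, (fun j t => if t \in I then A j t else 0), B; split=> [j|t x _].
  split; last exact: (HAB j).2.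
  move=> m mN; have [->|/eqP mn] := eqVneq m n.
    have [P sP AP] := (HAB j).1; exists P => // s sI.
    by rewrite mem_set// AP.
  exists 0; first by rewrite size_poly0.
  move=> s sm; rewrite horner0 ifF//.
  by apply/negbTE; rewrite notin_setE; exact: time_elt_disjoint sm.
case: ifPn => [/set_mem tI|_]; first by rewrite HE.
by rewrite mxE big1// => j _; rewrite mul0r.
Qed.

Lemma spacetime_integral_restrict (F G : R -> R -> R) :
  (forall t x, I t -> F t x = G t x) ->
  (forall t x, ~ I t -> F t x = 0) ->
  spacetime_integral `[0, T]%classic F = spacetime_integral I G.
Proof.
move=> FG F0.
have -> : I = `[0, T]%classic `&` I.
  by apply/esym/setIidr; exact: time_elt_subset.
rewrite /spacetime_integral Rintegral_mkcondr.
apply: eq_Rintegral => t _; rewrite patchE; case: ifPn => [/set_mem|] tI.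
  by congr space_integral; apply/funext => x; exact: FG.
rewrite -[RHS]/(0 : R) -(mul0r (fine (lebesgue_measure (@circle R)))).
rewrite -Rintegral_cst; last exact: measurable_itv.
by apply: eq_Rintegral => x _; rewrite F0// => /mem_set; exact/negP.
Qed.

End Localization.

(** Test with [phi] extended by zero, and replace the derivatives of [Z]
    by the explicit elementwise ones. *)
Lemma fem_solution_element (R : realType) (D : nat) (T : R) (K L : 'M[R]_D)
    (S : 'cV[R]_D -> R) (hS : continuously_differentiable S)
    (N : nat) (t_ : nat -> R) (M : nat) (x_ : nat -> R) (q p n : nat)
    (Z Zt Zx Ztx phi : R -> R -> 'cV[R]_D) :
  is_mesh 0 T N t_ -> (n < N)%N -> is_mesh 0 1 M x_ ->
  (forall phi : R -> R -> 'cV[R]_D,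
     tensor_space `[0, T] (time_D N t_ q) (space_C M x_ p) phi ->
     spacetime_integral `[0, T] (fun t x =>
       dot (K *m dt Z t x) (phi t x) + dot (L *m dx Z t x) (phi t x)
       - dot (grad S (Z t x)) (phi t x)) = 0) ->
  (forall i, fe_tensor (t_ n) (t_ n.+1) M x_ p q.+1 (fun t x => Z t x i 0)) ->
  tensor_space `[t_ n, t_ n.+1[ (poly_on `[t_ n, t_ n.+1[ q) (space_C M x_ p) Zt ->
  col_jet (t_ n) (t_ n.+1) M x_ Z Zt Zx Ztx ->
  tensor_space `[t_ n, t_ n.+1[ (poly_on `[t_ n, t_ n.+1[ q) (space_C M x_ p) phi ->
  spacetime_integral `[t_ n, t_ n.+1[ (fun t x =>
    dot (K *m Zt t x) (phi t x) + dot (L *m Zx t x) (phi t x)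
    - dot (grad S (Z t x)) (phi t x)) = 0.
Proof.
move=> ht hn hx fem ZP VZt jetZ Vphi.
rewrite -[RHS](fem _ (extend_by_zero_tensor ht hn Vphi)).
rewrite (spacetime_integral_restrict ht hn (G := fun t x =>
    dot (K *m dt Z t x) (phi t x) + dot (L *m dx Z t x) (phi t x)
    - dot (grad S (Z t x)) (phi t x))); first last.
- move=> t x tI; rewrite ifF; last by apply/negbTE; rewrite notin_setE.
  by rewrite !dot0r addr0 subr0.
- by move=> t x tI; rewrite mem_set.
apply/esym/(spacetime_integral_eq hx) => [|m t x mM tab xm].
  exact: (cellwise_fem_residual ZP VZt jetZ).
by rewrite (dt_jet jetZ)// (dx_jet jetZ mM).
Qed.

Unset Implicit Arguments.
Set Strict Implicit.
Set Printing Implicit Defensive.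

Theorem theorem3p6 (R : realType) (D : nat) (hD : (2 <= D)%N)
  (T : R) (hT : 0 < T)
  (K L : 'M[R]_D) (hK : skew_symmetric K) (hL : skew_symmetric L)
  (S : 'cV[R]_D -> R) (hS : continuously_differentiable S)
  (N : nat) (t_ : nat -> R) (ht : is_mesh 0 T N t_)
  (M : nat) (x_ : nat -> R) (hx : is_mesh 0 1 M x_)
  (q p : nat) (hp : (1 <= p)%N)
  (z0 : R -> 'cV[R]_D) (hz0 : L2_circle z0)
  (Z : R -> R -> 'cV[R]_D)
  (hZ : fem_solution K L S T N t_ M x_ q p z0 Z)
  (n : nat) (hn : (n < N)%N) :
  spacetime_integral (time_elt t_ n) (fun t x =>
    dt (momentum_density K Z) t x
    + dx (fun s y => momentum_flux K S Z s y + S (Z s y)) t x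
    - momentum_W S t_ M x_ q p Z n t x) = 0
  /\
  spacetime_integral (time_elt t_ n) (fun t x =>
    dt (energy_density L S Z) t x + dx (energy_flux L Z) t x) = 0.
Proof.
have [VZ fem _] := hZ; have [_ _ lt_t] := ht; have ab := lt_t n hn.
have ZP i := tensor_C_fe_tensor ht hn i VZ.
have [Zt [Zx [Ztx [VZt jetZ]]]] := exists_col_jet ZP.
have femn phi := fem_solution_element (phi := phi) hS ht hn hx fem ZP VZt jetZ.
have cellx m t x mM tab xm := @dx_jet _ _ _ _ _ _ _ _ _ _ jetZ m t x mM tab xm.
have [cZx _ _ _] := jetZ.
have cdxZ : col_cellwise (t_ n) (t_ n.+1) M x_ (dx Z).
  by move=> i; apply: cellwise_eq (cZx i) => m t x mM tab xm; rewrite (cellx m).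
have [VP PP] := L2proj_spacetimeP q p ab hx cdxZ.
split; last exact: (energy_law hx ZP VZt jetZ hS hK hL femn).
apply: (momentum_law hx ZP VZt jetZ hS hK hL femn VP) => v Vv.
rewrite (PP v Vv); apply: (spacetime_integral_eq hx) => [|m t x mM tab xm].
  by apply: cellwise_dot => //; exact: tensor_col_cellwise Vv.
by rewrite (cellx m).
Qed.
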